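(* Let $G$ be a finite group such that $\operatorname{rank}(G^n)=n\operatorname{rank}(G)$ for every integer $n\ge 1$. Then $G$ satisfies the weak conjecture, i.e. for every $n\ge1$ there exists a generating set $A$ of $G^n$ with $|A|=\operatorname{rank}(G^n)$ and $$\operatorname{diam}(G^n,A)\le n\,(|G|-\operatorname{rank}(G)).$$ In particular, every finite nilpotent group $G$ has the property that $\operatorname{rank}(G^n)=n\operatorname{rank}(G)$ for every $n\ge 1$, and hence satisfies the weak conjecture.
   Context: For a finite group $G$ with generating set $A$ and $g\in G$, $l_A(g)$ is the length of a shortest word in the elements of $A$ (no inverses allowed) representing $g$; the identity is represented by the empty word, of length $0$. The diameter is $\operatorname{diam}(G,A)=\max\{l_A(g): g\in G\}$. $\operatorname{rank}(G)$ is the minimum cardinality of a generating set of $G$. $G^n$ is the $n$-th direct power of $G$. *)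

(* Defs.v *)
From mathcomp Require Import all_boot all_fingroup all_solvable.

Set Implicit Arguments.
Unset Strict Implicit.
Unset Printing Implicit Defensive.

Local Open Scope group_scope.

Section Diameter.

Variable gT : finGroupType.
Implicit Types (A G : {set gT}) (g : gT).

Definition has_word A g (n : nat) : bool :=
  [exists w : n.-tuple gT, all [in A] w && (\prod_(a <- w) a == g)].

(* In a finite group the submonoid generated by A is the subgroup <<A>>. *)
Lemma has_word_gen A g : g \in <<A>> -> exists n, has_word A g n.
Proof.
case/gen_prodgP=> n [c Ac ->]; exists n; apply/existsP.
exists [tuple c i | i < n]; apply/andP; split.
  by apply/allP=> x /mapP[i _ ->]; exact: Ac.
by rewrite big_tuple; apply/eqP/eq_bigr=> i _; rewrite tnth_mktuple.
Qed.

(* The value 0 for g outside <<A>> is a dummy: there is no word for g then. *)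
Definition word_length A g : nat :=
  if @idP (g \in <<A>>) is ReflectT gA then ex_minn (has_word_gen gA) else 0.

(* Meaningful when <<A>> = G. *)
Definition diam G A : nat := \max_(g in G) word_length A g.

End Diameter.

Definition direct_power (gT : finGroupType) (G : {group gT}) (n : nat) :
    {group {dffun forall i : 'I_n, gT}} :=
  [group of setXn (fun _ : 'I_n => G : {set gT})].

(* 'm(G) is the least cardinality of a generating set of G; since           *)
(* 'm(G) <= #|G|, the subtractions below are never truncated.                *)

Definition rank_additive (gT : finGroupType) (G : {group gT}) : Prop :=
  forall n : nat, 1 <= n -> 'm(direct_power G n) = (n * 'm(G))%N.

Definition weak_conjecture (gT : finGroupType) (G : {group gT}) : Prop :=
  forall n : nat, 1 <= n ->
  exists A : {set {dffun forall i : 'I_n, gT}},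
    [/\ <<A>> = direct_power G n,
        #|A| = 'm(direct_power G n)
      & diam (direct_power G n) A <= (n * (#|G| - 'm(G)))%N].

(* Main.v *)
(** If [1 \notin B], the prefixes of length [0, 2, 3, ...] of a shortest word
    over [B] are pairwise distinct and lie outside [B], so lengths over [B] are at most
    [#|<<B>>| - #|B|].  The copies of a minimum generating set of [G] in the
    [n] coordinates generate [G^n], every coordinate adding at most that much
    to the length, and there are at most [n * 'm(G)] of them.

    For nilpotent [G], the quotient [A = G / 'Phi(G)] is abelian and needs
    ['m(G)] generators, and its generating rank is ['r_p(A)] for some prime
    [p].  Killing the [p']-part of [A] and then a second Frattini subgroup
    maps [G] onto an elementary abelian [p]-group [E] with ['m(E) = 'm(G)].
    Hence [G^n] maps onto [E^n], which needs [n * 'm(G)] generators. *)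

Require Import Defs.
From mathcomp Require Import all_boot all_fingroup all_solvable.

Set Implicit Arguments.
Unset Strict Implicit.
Unset Printing Implicit Defensive.

Local Open Scope group_scope.

(** * Word lengths over a generating set *)

Section Words.

Variable gT : finGroupType.
Implicit Types (A B : {set gT}) (g h : gT).

Lemma has_wordP A g n :
  reflect (exists s : seq gT,
             [/\ size s = n, all [in A] s & \prod_(a <- s) a = g])
          (has_word A g n).
Proof.
apply: (iffP existsP) => [[w /andP[Aw /eqP defg]] | [s [sz_s As defg]]].
  by exists w; rewrite size_tuple.
have sz_s' : size s == n by rewrite sz_s.
by exists (Tuple sz_s') => /=; rewrite As defg eqxx.
Qed.

Lemma has_word1 A : has_word A 1 0.
Proof. by apply/has_wordP; exists [::]; rewrite big_nil. Qed.

Lemma has_word_mem A g : g \in A -> has_word A g 1.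
Proof. by move=> Ag; apply/has_wordP; exists [:: g]; rewrite big_seq1 /= Ag. Qed.

Lemma has_wordM A g h m n :
  has_word A g m -> has_word A h n -> has_word A (g * h) (m + n).
Proof.
case/has_wordP=> s [<- As <-] /has_wordP[t [<- At <-]].
by apply/has_wordP; exists (s ++ t); rewrite size_cat all_cat As At big_cat.
Qed.

Lemma has_word_prod A (I : finType) (F : I -> gT) (l : I -> nat) :
  (forall i, has_word A (F i) (l i)) ->
  has_word A (\prod_i F i) (\sum_i l i).
Proof.
move=> Fl; elim/big_ind2: _ => //; first exact: has_word1.
by move=> g m h n; apply: has_wordM.
Qed.

Lemma has_word_mem_gen A g n : has_word A g n -> g \in <<A>>.
Proof.
case/has_wordP=> s [_ /allP As <-]; rewrite big_seq group_prod // => a sa.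
exact/mem_gen/As.
Qed.

Lemma word_lengthP A g : g \in <<A>> -> has_word A g (word_length A g).
Proof. by rewrite /word_length; case: {-}_ / idP => // gA _; case: ex_minnP. Qed.

Lemma word_length_le A g n : has_word A g n -> word_length A g <= n.
Proof.
by rewrite /word_length; case: {-}_ / idP => // gA gn; case: ex_minnP => m _; apply.
Qed.

Lemma word_length_le_card B g :
  1 \notin B -> word_length B g <= #|<<B>>| - #|B|.
Proof.
(* Outside [<<B>>] the length is the dummy value 0. *)
move=> B1; have [gB|gB'] := boolP (g \in <<B>>); last first.
  by rewrite /word_length; case: {-}_ / idP => // gB; rewrite gB in gB'.
case/has_wordP: (word_lengthP gB) => w [sz_w Bw defg].
case L0: (word_length B g) => [|l] //; rewrite L0 in sz_w.
pose pre i := \prod_(a <- take i w) a.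
have pre_word i : i <= l.+1 -> has_word B (pre i) i.
  move=> le_i; apply/has_wordP; exists (take i w).
  rewrite size_takel ?sz_w //; split=> //.
  by move: Bw; rewrite -{1}(cat_take_drop i w) all_cat => /andP[].
(* A shorter word for a prefix, followed by the rest of [w], would give a word for [g] shorter than
   the shortest one. *)
have pre_min i m : i <= l.+1 -> has_word B (pre i) m -> i <= m.
  move=> le_i pre_m; have: has_word B g (m + (l.+1 - i)).
    rewrite -defg -(cat_take_drop i w) big_cat /= has_wordM //.
    apply/has_wordP; exists (drop i w); rewrite size_drop sz_w; split=> //.
    by move: Bw; rewrite -{1}(cat_take_drop i w) all_cat => /andP[].
  move/word_length_le; rewrite L0 addnBA // leq_subRL; last first.
    exact: leq_trans (leq_addl _ _).
  by rewrite leq_add2r.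
(* Length 1 is skipped because that prefix is a letter of [B]. The lengths kept still number [l.+1],
   the length of [g]. *)
pose ks := 0 :: iota 2 l.
have ks_le k : k \in ks -> k <= l.+1.
  by rewrite inE mem_iota add2n ltnS => /predU1P[->|/andP[]].
have uniq_pre : uniq [seq pre k | k <- ks].
  rewrite map_inj_in_uniq ?cons_uniq ?mem_iota ?iota_uniq // => i j.
  move=> /ks_le le_i /ks_le le_j eq_ij; apply/eqP; rewrite eqn_leq.
  by rewrite (pre_min i) ?eq_ij ?pre_word // (pre_min j) -?eq_ij ?pre_word.
have <- : size [seq pre k | k <- ks] = l.+1 by rewrite size_map /= size_iota.
have /eqP <- : #|<<B>> :\: B| == #|<<B>>| - #|B|.
  by rewrite cardsD (setIidPr (subset_gen B)).
rewrite cardE uniq_leq_size // => _ /mapP[k ks_k ->]; rewrite mem_enum inE.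
rewrite (has_word_mem_gen (pre_word k (ks_le k ks_k))) andbT.
have le_k := ks_le k ks_k; move: ks_k; rewrite inE.
case/predU1P=> [->|]; first by rewrite /pre take0 big_nil.
(* A prefix lying in [B] is also a one-letter word, so [pre_min] bounds its length [k] by 1. *)
rewrite mem_iota => /andP[k_gt1 _]; apply: contraTN k_gt1 => /has_word_mem.
by move/(pre_min k 1%N le_k); rewrite leqNgt.
Qed.

End Words.

(** Deleting 1 leaves the generated subgroup unchanged, so a generating set of least cardinality
    cannot contain it. *)
Lemma grank_witness1 (gT : finGroupType) (G : {group gT}) :
  exists B : {set gT}, [/\ <<B>> = G, #|B| = 'm(G) & 1 \notin B].
Proof.
have [B defG oB] := grank_witness G; exists B; split=> //; apply/negP=> B1.
have := grank_min B^#; rewrite genD1id defG -oB (cardsD1 1 B) B1.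
by rewrite ltnn.
Qed.

(** * Generating a direct power coordinate by coordinate *)

Section PowerGenerators.

Variables (gT : finGroupType) (n : nat).
Implicit Types (B : {set gT}).

Definition power_gens B : {set {dffun forall i : 'I_n, gT}} :=
  \bigcup_(i < n) [set dfung1 (i := i) b | b in B].

Lemma card_power_gens B : #|power_gens B| <= n * #|B|.
Proof.
rewrite -[n in (n * _)%N]card_ord -sum_nat_const.
apply: (@leq_trans (\sum_(i < n) #|[set dfung1 (i := i) b | b in B]|)); last first.
  by apply: leq_sum => i _; apply: leq_imset_card.
rewrite /power_gens; elim/big_rec2: _ => [|i m S _ leSm]; first by rewrite cards0.
by rewrite (leq_trans (leq_card_setU _ _)) // leq_add2l.
Qed.

Lemma has_word_dfung1 B i g m :
  has_word B g m -> has_word (power_gens B) (dfung1 (i := i) g) m.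
Proof.
case/has_wordP=> s [<- /allP Bs <-].
apply/has_wordP; exists (map (dfung1 (i := i)) s).
rewrite size_map big_map; split=> //.
  apply/allP=> _ /mapP[b sb ->]; apply/bigcupP; exists i => //.
  exact/imset_f/Bs.
by rewrite (big_morph _ (@dfung1_morphM _ _ i) (morph1 _)).
Qed.

Lemma prod_dfung1 (x : {dffun forall i : 'I_n, gT}) :
  x = \prod_i dfung1 (i := i) (x i).
Proof.
apply/ffunP=> j; rewrite prodg_ffun (big_only1 j) ?dfung1_id // => i ij _.
by rewrite dfung1_dflt.
Qed.

Lemma has_word_power B (x : {dffun forall i : 'I_n, gT}) :
    x \in direct_power <<B>>%G n ->
  has_word (power_gens B) x (\sum_i word_length B (x i)).
Proof.
move=> /setXnP Gx; rewrite {1}[x]prod_dfung1; apply: has_word_prod => i.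
exact/has_word_dfung1/word_lengthP/Gx.
Qed.

Lemma power_gens_gen B : <<power_gens B>> = direct_power <<B>>%G n.
Proof.
apply/eqP; rewrite eqEsubset gen_subG; apply/andP; split; last first.
  by apply/subsetP=> x /has_word_power/has_word_mem_gen.
apply/bigcupsP=> i _; apply/subsetP=> _ /imsetP[b Bb ->].
apply/setXnP=> j; have [<-|ij] := eqVneq i j; first by rewrite dfung1_id mem_gen.
by rewrite dfung1_dflt.
Qed.

Lemma diam_power_gens B :
    1 \notin B ->
  diam (direct_power <<B>>%G n) (power_gens B) <= n * (#|<<B>>| - #|B|).
Proof.
move=> B1; apply/bigmax_leqP=> x /has_word_power/word_length_le le_x.
apply: leq_trans le_x _; rewrite -[n in (n * _)%N]card_ord -sum_nat_const.
by apply: leq_sum => i _; apply: word_length_le_card.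
Qed.

End PowerGenerators.

Lemma grank_direct_power_le (gT : finGroupType) (G : {group gT}) n :
  'm(direct_power G n) <= n * 'm(G).
Proof.
have [B defG <-] := grank_witness G.
have -> : G = <<B>>%G by apply/val_inj; rewrite /= defG.
rewrite -power_gens_gen; exact: leq_trans (grank_min _) (card_power_gens _ _).
Qed.

Lemma rank_additive_weak_conjecture (gT : finGroupType) (G : {group gT}) :
  rank_additive G -> weak_conjecture G.
Proof.
have [B [defG oB B1]] := grank_witness1 G.
have -> : G = <<B>>%G by apply/val_inj; rewrite /= defG.
rewrite -{}defG in oB; move=> mG n n_gt0; exists (power_gens n B).
rewrite power_gens_gen -oB diam_power_gens //; split=> //.
(* A generating set has at least as many elements as the rank. Conversely, this one has at most
   [n * #|B|] elements, which is the rank by additivity. *)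
apply/eqP; rewrite eqn_leq -{2}power_gens_gen grank_min andbT.
by rewrite mG // -oB card_power_gens.
Qed.

(** * Ranks of powers of homomorphic images and of elementary abelian groups *)

Lemma grank_morphim_power (aT rT : finGroupType) (D : {group aT})
    (f : {morphism D >-> rT}) (G : {group aT}) n :
  G \subset D -> 'm(direct_power (f @* G)%G n) <= 'm(direct_power G n).
Proof.
move=> sGD.
(* Applied in each coordinate, [f] maps the power of [G] onto the power of its image, and a
   homomorphic image needs no more generators than its source. *)
pose fn (x : {dffun forall i : 'I_n, aT}) : {dffun forall i : 'I_n, rT} :=
  [ffun i => f (x i)].
have fnM : {in direct_power D n &, {morph fn : x y / x * y}}.
  move=> x y /setXnP Dx /setXnP Dy; apply/ffunP=> i; rewrite !ffunE.
  by rewrite morphM ?Dx ?Dy.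
have sGDn : direct_power G n \subset direct_power D n by apply: setXnS.
have <- : Morphism fnM @* direct_power G n = direct_power (f @* G)%G n.
  rewrite morphimEsub //; apply/setP=> y; apply/imsetP/setXnP=> [[x Gx ->] i|fGy].
    by rewrite ffunE mem_morphim ?(subsetP sGD) //; apply: (setXnP Gx).
  have /fin_all_exists2[x Gx fx] i : exists2 u, u \in G & y i = f u.
    by have /morphimP[u _ Gu ->] := fGy i; exists u.
  exists [ffun i => x i]; first by apply/setXnP=> i; rewrite ffunE.
  by apply/ffunP=> i; rewrite !ffunE.
exact: morphim_grank.
Qed.

Lemma direct_power_abelem (gT : finGroupType) p (E : {group gT}) n :
  prime p -> p.-abelem E -> p.-abelem (direct_power E n).
Proof.
move=> p_pr /abelemP[] // cEE expE; apply/abelemP=> //; split.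
  apply/centsP=> x /setXnP Ex y /setXnP Ey; apply/ffunP=> i; rewrite !ffunE.
  exact: (centsP cEE).
move=> x /setXnP Ex; apply/ffunP=> i.
have -> : (x ^+ p) i = x i ^+ p.
  by elim: (p) => [|k IHk]; rewrite ?expgS ffunE ?IHk.
by rewrite ffunE expE.
Qed.

Lemma grank_abelem (gT : finGroupType) p (E : {group gT}) :
  p.-abelem E -> 'm(E) = logn p #|E|.
Proof.
by move=> abE; rewrite grank_abelian ?(abelem_abelian abE) // (rank_abelem abE).
Qed.

(** The rank of an elementary abelian group is its dimension over the field of [p] elements, and the
    order of the power is [#|E| ^ n]. *)
Lemma grank_direct_power_abelem (gT : finGroupType) p (E : {group gT}) n :
  prime p -> p.-abelem E -> 'm(direct_power E n) = (n * 'm(E))%N.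
Proof.
move=> p_pr abE; rewrite (grank_abelem abE).
rewrite (grank_abelem (direct_power_abelem n p_pr abE)) cardsXn.
by rewrite prod_nat_const card_ord lognX.
Qed.

(** * Rank-preserving quotients of nilpotent groups *)

Lemma grank_quotient_Phi (gT : finGroupType) (G : {group gT}) :
  'm(G / 'Phi(G)) = 'm(G).
Proof.
have nPhiG : G \subset 'N('Phi(G)) := gFnorm _ G.
apply/eqP; rewrite eqn_leq quotient_grank //=.
have [B defB <-] := grank_witness (G / 'Phi(G))%G.
(* A minimum generating set of the quotient is lifted to [G]; [rep] takes the dummy value 1 outside
   [B]. *)
have /fin_all_exists[rep repP] xb :
    exists x, xb \in B -> x \in G /\ coset 'Phi(G) x = xb.
  have [Bxb|_] := boolP (xb \in B); last by exists 1.
  have: xb \in G / 'Phi(G) by rewrite -defB mem_gen.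
  by case/morphimP=> x _ Gx ->; exists x.
have sXG : rep @: B \subset G.
  by apply/subsetP=> _ /imsetP[xb /repP[Gx _] ->].
have defXq : rep @: B / 'Phi(G) = B.
  apply/setP=> xb; apply/idP/idP=> [/morphimP[_ _ /imsetP[yb Byb ->] ->]|Bxb].
    by have [_ /= ->] := repP yb Byb.
  have [Gx def_xb] := repP xb Bxb; rewrite -[X in X \in _]def_xb.
  by rewrite mem_morphim ?imset_f // (subsetP nPhiG).
suffices defG : <<rep @: B>> = G.
  by rewrite -[X in 'm(X)]defG (leq_trans (grank_min _)) ?leq_imset_card.
(* The lifts generate [G] modulo ['Phi(G)], whose elements are non-generators. *)
apply: Phi_nongen; apply/eqP; rewrite eqEsubset join_subG Phi_sub sXG /=.
rewrite -joing_idr norm_joinEr ?gen_subG ?(subset_trans sXG) //.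
by rewrite -quotientSK // quotient_gen ?(subset_trans sXG) // defXq defB.
Qed.

Lemma maximal_nilpotent_der1 (gT : finGroupType) (G M : {group gT}) :
  nilpotent G -> maximal M G -> G^`(1) \subset M.
Proof.
move=> nilG maxM; have [/andP[sMG not_sGM] maxMP] := maxgroupP maxM.
(* If the normaliser of [M] in [G] were proper, maximality would make it [M], against the normaliser
   condition in nilpotent groups. *)
have nMG : G \subset 'N(M).
  have := subsetIl G 'N(M); rewrite subEproper.
  case/predU1P=> [/setIidPl-> // | /maxMP/= defN]; case/negP: not_sGM.
  rewrite {1}(nilpotent_sub_norm nilG sMG) //.
  by rewrite defN // subsetI sMG normG.
have nMder := subset_trans (der_sub 1 G) nMG.
(* By maximality this join is [M] or [G]. In the second case [G / M] would be nontrivial, solvable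
   and equal to its derived subgroup. *)
have: M <*> G^`(1) \subset G by rewrite join_subG sMG der_sub.
rewrite subEproper => /predU1P[defG | /maxMP <-]; rewrite ?joing_subl ?joing_subr //.
case/negP: not_sGM; rewrite -quotient_sub1 // subG1; apply/negPn/negP => ntGM.
have solGM : solvable (G / M) by rewrite quotient_sol ?nilpotent_sol.
have := sol_der1_proper solGM (subxx _) ntGM.
rewrite properE -quotient_der // andbC quotientSK // -norm_joinEr //.
by rewrite defG subxx.
Qed.

Lemma nilpotent_quotient_Phi_abelian (gT : finGroupType) (G : {group gT}) :
  nilpotent G -> abelian (G / 'Phi(G)).
Proof.
(* The intersection defining ['Phi(G)] includes [G] itself beside its maximal subgroups. *)
move=> nilG; apply: sub_der1_abelian; apply/bigcapsP=> M /predU1P[->|].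
  exact: der_sub.
exact: maximal_nilpotent_der1.
Qed.

(** The prime is one whose [p]-rank attains the rank of [A]; a quotient by a [p']-subgroup keeps the
    [p]-rank. *)
Lemma abelian_grank_p_quotient (gT : finGroupType) (A : {group gT}) :
  abelian A ->
  exists2 p, prime p &
    'm(A / 'O_p^'(A)) = 'm(A) /\ p.-group (A / 'O_p^'(A)).
Proof.
move=> cAA; have [p p_pr rA] := rank_witness A; exists p => //.
have nQA : A \subset 'N('O_p^'(A)) := gFnorm _ A.
have pQ : p.-group (A / 'O_p^'(A)).
  (* [A] is the product of its [p]- and [p']-cores, so the quotient is an image of the [p]-core. *)
  have /dprodP[_ defA _ _] := nilpotent_pcoreC p (abelian_nil cAA).
  by rewrite -[A in A / _]defA quotientMidr quotient_pgroup ?pcore_pgroup.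
split=> //; rewrite !grank_abelian ?quotient_abelian // (rank_pgroup pQ) rA.
by rewrite p_rank_p'quotient ?pcore_pgroup.
Qed.

Lemma nilpotent_rank_additive (gT : finGroupType) (G : {group gT}) :
  nilpotent G -> rank_additive G.
Proof.
move=> nilG n _; apply/eqP; rewrite eqn_leq grank_direct_power_le /=.
have cAA := nilpotent_quotient_Phi_abelian nilG.
have [p p_pr [mP pP]] := abelian_grank_p_quotient cAA.
set A := (G / 'Phi(G))%G in cAA mP pP.
set P := (A / 'O_p^'(A))%G in mP pP.
have abE : p.-abelem (P / 'Phi(P))%G := Phi_quotient_abelem pP.
have <- : 'm(P / 'Phi(P)) = 'm(G).
  by rewrite grank_quotient_Phi mP grank_quotient_Phi.
rewrite -(grank_direct_power_abelem n p_pr abE).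
(* The three quotient maps from [G] to [P / 'Phi(P)] are lifted to powers one at a time. *)
do 2![apply: leq_trans (grank_morphim_power _ _ _) _; first exact: gFnorm].
by apply: grank_morphim_power; apply: gFnorm.
Qed.

Theorem mainTheorem2 (gT : finGroupType) (G : {group gT}) :
  (rank_additive G -> weak_conjecture G) /\
  (nilpotent G -> rank_additive G /\ weak_conjecture G).
Proof.
split=> [|nilG]; first exact: rank_additive_weak_conjecture.
have mG := nilpotent_rank_additive nilG.
by split=> //; apply: rank_additive_weak_conjecture.
Qed.
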